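(* Let $n,k$ be integers with $n\ge 97$ and $\frac{3n}{4}\le k\le n$. Then $$\overline{\mathrm{dist}}_F(\mathcal{S}^{n,k},\mathcal{S}^n_+)\le 96\left(\frac{n-k}{n}\right)^{3/2}.$$
   Context: $\mathcal{S}^n_+$ denotes the cone of $n\times n$ real symmetric positive semidefinite (PSD) matrices. For integers $2\le k\le n$, the $k$-PSD closure $\mathcal{S}^{n,k}$ is the set of all $n\times n$ real symmetric matrices all of whose $k\times k$ principal submatrices are PSD. For a matrix $M$, $\mathrm{dist}_F(M,\mathcal{S}^n_+)=\inf_{N\in\mathcal{S}^n_+}\|M-N\|_F$, where $\|\cdot\|_F$ is the Frobenius norm. For a set $\mathcal{K}$ of $n\times n$ matrices, $\overline{\mathrm{dist}}_F(\mathcal{K},\mathcal{S}^n_+)=\sup_{M\in\mathcal{K},\ \|M\|_F=1}\mathrm{dist}_F(M,\mathcal{S}^n_+)$. *)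

(* Defs.v *)
From HB Require Import structures.
From mathcomp Require Import all_boot all_order all_algebra.
From mathcomp Require Import all_classical all_reals all_analysis.
Set Implicit Arguments. Unset Strict Implicit. Unset Printing Implicit Defensive.
Import Order.TTheory GRing.Theory Num.Theory.
Local Open Scope ring_scope.
Local Open Scope classical_set_scope.

Section Defs.
Variable R : realType.

Definition psd (n : nat) (A : 'M[R]_n) : Prop :=
  A^T = A /\ forall x : 'cV[R]_n, 0 <= (x^T *m A *m x) 0 0.

Definition principal_sub (n k : nat) (f : 'I_k -> 'I_n) (A : 'M[R]_n) : 'M[R]_k :=
  mxsub f f A.

Definition kpsd (n k : nat) (A : 'M[R]_n) : Prop :=
  A^T = A /\
  forall f : 'I_k -> 'I_n, (forall i j : 'I_k, (i < j)%N -> (f i < f j)%N) ->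
    psd (principal_sub f A).

Definition frob (n : nat) (A : 'M[R]_n) : R :=
  Num.sqrt (\sum_(i < n) \sum_(j < n) A i j ^+ 2).

Definition distF_psd (n : nat) (M : 'M[R]_n) : \bar R :=
  ereal_inf [set (frob (M - N))%:E | N in [set N : 'M[R]_n | psd N]].

Definition supdistF_psd (n : nat) (K : set 'M[R]_n) : \bar R :=
  ereal_sup [set distF_psd M | M in [set M | K M /\ frob M = 1]].

End Defs.

(* Main.v *)
Require Import Defs.
From HB Require Import structures.
From mathcomp Require Import all_boot all_order all_algebra.
From mathcomp Require Import all_classical all_reals all_analysis.
From mathcomp Require Import ring lra zify.
From mathcomp.real_closed Require Import complex.
Import Order.TTheory GRing.Theory Num.Theory.
Local Open Scope ring_scope.

(* Write r = n - k and Q(x) = x^T M x for M in the k-PSD closure with |M|_F = 1.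
   By interlacing M has at most r negative eigenvalues, and replacing them by 0
   gives a PSD matrix, so dist(M, PSD) <= sqrt r * lam as soon as Q >= - lam on
   the unit sphere. It remains to see that lam = 6 r / n^(3/2) will do.
   At least 3n/4 of the diagonal entries are at most 2 / sqrt n; let L be the
   set of their indices. Given v, keep its coordinates outside L, delete r random
   coordinates in L and rescale the others in L so that the expectation is v.
   The result x has only k nonzero coordinates, so 0 <= E Q(x), and E Q(x) - Q(v)
   is at most of order (r / n) max_L M_ii + r / n^2 = O(r / n^(3/2)). *)

(** * Counting and second moments of a random [t]-subset of [L] *)

(** Union with [A] maps the subsets of [B :\: A] of size [k - #|A|] bijectively onto the sets
    counted. *)
Lemma card_draws_between (T : finType) (A B : {set T}) (k : nat) :
  A \subset B -> (#|A| <= k)%N ->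
  #|[set S : {set T} | [&& A \subset S, S \subset B & #|S| == k]]|
    = 'C(#|B| - #|A|, k - #|A|).
Proof.
move=> sAB leAk.
have cBA : #|B :\: A| = (#|B| - #|A|)%N.
  by rewrite -(cardsID A B) (finset.setIidPr sAB) addKn.
rewrite -cBA -cards_draws.
rewrite -[RHS](card_in_imset (f := finset.setU A)); last first.
  move=> S S'; rewrite !inE => /andP[+ _] /andP[+ _].
  rewrite !subsetD => /andP[_ dS] /andP[_ dS'] eqU.
  have restr (X : {set T}) : [disjoint X & A] -> (A :|: X) :\: A = X.
    by move=> dX; rewrite finset.setDUl finset.setDv finset.set0U; apply/finset.setDidPl.
  by rewrite -(restr S) // eqU restr.
apply: eq_card => S; rewrite !inE; apply/idP/imsetP => [/and3P[sAS sSB /eqP cS]|].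
  exists (S :\: A); last by rewrite -{1}(finset.setID S A) (finset.setIidPr sAS).
  rewrite inE finset.setSD //=; apply/eqP.
  by rewrite -cS -(cardsID A S) (finset.setIidPr sAS) addKn.
move=> [X]; rewrite inE subsetD => /andP[/andP[sXB dX] /eqP cX] ->.
rewrite finset.subsetUl finset.subUset sAB sXB /=; apply/eqP.
have /eqP-> : #|A :|: X| == (#|A| + #|X|)%N by rewrite (leq_card_setU A X) disjoint_sym.
by rewrite cX subnKC.
Qed.

Section Averaging.
Context {R : realFieldType} {n : nat}.
Variables (L : {set 'I_n}) (t : nat).
Hypotheses (t2 : (2 <= t)%N) (tL : (t <= #|L|)%N).
Local Notation m := #|L|.

Definition draws := [set T : {set 'I_n} | T \subset L & #|T| == t].

(* The factor m / t makes each weight have mean 1 over the draws; distinct elements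
   of L then have weights of covariance [- defect]. *)
Definition weight (T : {set 'I_n}) (i : 'I_n) : R :=
  (i \notin L)%:R + m%:R / t%:R * (i \in T)%:R.

Definition defect : R := (m - t)%:R / (t%:R * (m%:R - 1)).

Lemma sum_draws_sup (A : {set 'I_n}) : A \subset L -> (#|A| <= t)%N ->
  \sum_(T in draws) (A \subset T)%:R = ('C(m - #|A|, t - #|A|))%:R :> R.
Proof.
move=> sAL cA; rewrite -card_draws_between // -sum1_card natr_sum.
rewrite [LHS](bigID (fun T : {set 'I_n} => A \subset T)) /=.
rewrite [X in _ + X]big1 ?addr0 => [|T /andP[_ /negbTE->] //].
apply: eq_big => [T|T /andP[_ ->] //].
by rewrite !inE andbC.
Qed.

(** For distinct i, j in L the mean of the product is (m/t)^2 * t(t-1)/(m(m-1)) = 1 - [defect]. For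
    i = j in L it is m/t = 1 + (m-t)/t, so the diagonal correction also has to restore [defect]. An
    index outside L has constant weight 1, which leaves the mean equal to 1. *)
Lemma sum_weights (i j : 'I_n) :
  \sum_(T in draws) weight T i * weight T j =
  ('C(m, t))%:R * (1 - defect * ((i \in L)%:R * (j \in L)%:R)
     + (i == j)%:R * ((m - t)%:R / t%:R + defect) * (i \in L)%:R).
Proof.
have t0 : t%:R != 0 :> R by rewrite pnatr_eq0; lia.
have m0 : m%:R != 0 :> R by rewrite pnatr_eq0; lia.
have m1 : m%:R - 1 != 0 :> R by rewrite subr_eq0 pnatr_eq1; lia.
have N1 : m%:R * ('C(m.-1, t.-1))%:R = t%:R * ('C(m, t))%:R :> R.
  by rewrite -!natrM mul_bin_diag prednK //; lia.
have N2 : (m%:R - 1) * ('C(m.-2, t.-2))%:R = (t%:R - 1) * ('C(m.-1, t.-1))%:R :> R.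
  have -> : m%:R - 1 = m.-1%:R :> R by rewrite -subn1 natrB //; lia.
  have -> : t%:R - 1 = t.-1%:R :> R by rewrite -subn1 natrB //; lia.
  by rewrite -!natrM mul_bin_diag prednK //; lia.
have N1' : ('C(m.-1, t.-1))%:R = t%:R / m%:R * ('C(m, t))%:R :> R.
  by apply: (mulfI m0); rewrite N1; field.
have N2' : ('C(m.-2, t.-2))%:R =
    (t%:R - 1) / (m%:R - 1) * (t%:R / m%:R * ('C(m, t))%:R) :> R.
  by apply: (mulfI m1); rewrite N2 N1'; field; rewrite m0 m1.
have S0 : \sum_(T in draws) 1 = ('C(m, t))%:R :> R.
  by rewrite -cards_draws -sum1_card natr_sum.
have S1 (x : 'I_n) : x \in L ->
    \sum_(T in draws) (x \in T)%:R = t%:R / m%:R * ('C(m, t))%:R :> R.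
  move=> xL; rewrite -N1' -!subn1 -(cards1 x) -sum_draws_sup ?cards1 ?finset.sub1set //; last lia.
  by apply: eq_bigr => T _; rewrite finset.sub1set.
have S2 : i != j -> i \in L -> j \in L ->
    \sum_(T in draws) (i \in T)%:R * (j \in T)%:R =
    (t%:R - 1) / (m%:R - 1) * (t%:R / m%:R * ('C(m, t))%:R) :> R.
  move=> ij iL jL; rewrite -N2' -!subn2.
  have c2 : #|[set i; j]| = 2%N by rewrite cards2 ij.
  rewrite -c2 -sum_draws_sup ?c2 //; last by rewrite finset.subUset !finset.sub1set iL.
  by apply: eq_bigr => T _; rewrite finset.subUset !finset.sub1set -natrM mulnb.
have notin (x : 'I_n) (T : {set 'I_n}) : x \notin L -> T \in draws -> (x \in T) = false.
  by move=> xL; rewrite inE => /andP[/fintype.subsetP sTL _]; apply: contraNF xL; apply: sTL.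
rewrite /weight /defect natrB //.
have [iL|iL] := boolP (i \in L); have [jL|jL] := boolP (j \in L) => /=.
- have [<-|ij] := eqVneq i j.
    transitivity (\sum_(T in draws) (m%:R / t%:R) ^+ 2 * (i \in T)%:R : R).
      by apply: eq_bigr => T _; case: (i \in T); rewrite /=; ring.
    rewrite -mulr_sumr S1 //=; field.
    by rewrite t0 m0 m1.
  transitivity (\sum_(T in draws) (m%:R / t%:R) ^+ 2 * ((i \in T)%:R * (j \in T)%:R) : R).
    by apply: eq_bigr => T _; ring.
  rewrite -mulr_sumr S2 //=; field.
  by rewrite t0 m0 m1.
- have -> : (i == j) = false by apply: contraNF jL => /eqP <-.
  transitivity (\sum_(T in draws) (m%:R / t%:R) * (i \in T)%:R : R).
    by apply: eq_bigr => T TD; rewrite (notin j) //=; ring.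
  rewrite -mulr_sumr S1 //=; field.
  by rewrite t0 m0 m1.
- transitivity (\sum_(T in draws) (m%:R / t%:R) * (j \in T)%:R : R).
    by apply: eq_bigr => T TD; rewrite (notin i) //=; ring.
  rewrite -mulr_sumr S1 //=; field.
  by rewrite t0 m0 m1.
- transitivity (\sum_(T in draws) 1 : R).
    by apply: eq_bigr => T TD; rewrite (notin i) // (notin j) //=; ring.
  rewrite S0; field.
  by rewrite t0 m1.
Qed.

Lemma draws_card_gt0 : (0 < #|draws|)%N.
Proof. by rewrite cards_draws bin_gt0. Qed.

(** For F i j = v_i M_ij v_j this gives the mean of Q at the reweighted v as Q(v) plus two error
    terms confined to L. *)
Lemma avg_quad (F : 'I_n -> 'I_n -> R) :
  \sum_(T in draws) \sum_i \sum_j weight T i * weight T j * F i j =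
  #|draws|%:R * (\sum_i \sum_j F i j - defect * (\sum_(i in L) \sum_(j in L) F i j)
     + ((m - t)%:R / t%:R + defect) * \sum_(i in L) F i i).
Proof.
have mem_mulr (G : 'I_n -> R) : \sum_(i in L) G i = \sum_i (i \in L)%:R * G i.
  by rewrite big_mkcond; apply: eq_bigr => i _; case: (i \in L); rewrite ?mul1r ?mul0r.
have eq_mulr i (G : 'I_n -> R) : \sum_j (i == j)%:R * G j = G i.
  rewrite (bigD1 i) //= eqxx mul1r big1 ?addr0 // => j ij.
  by rewrite eq_sym (negbTE ij) mul0r.
have distr (a b c : R) (u v w : 'I_n -> R) :
    a * (\sum_j u j - b * (\sum_j v j) + c * \sum_j w j)
      = \sum_j a * (u j - b * v j + c * w j).
  by rewrite -mulr_sumr big_split sumrB /= !mulr_sumr.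
rewrite exchange_big /= !mem_mulr distr.
apply: eq_bigr => i _ /=; rewrite exchange_big /= mem_mulr.
rewrite -[F i i](eq_mulr i (F i)) [defect * _]mulrA [X in _ + X]mulrA distr.
apply: eq_bigr => j _; rewrite -mulr_suml sum_weights cards_draws.
by ring.
Qed.

End Averaging.

(** * Lower bounds for a quadratic form *)

Section QuadraticForm.
Context {R : realFieldType} {n : nat}.

Definition qform (M : 'M[R]_n) (x : 'cV[R]_n) : R := (x^T *m M *m x) 0 0.

Definition sqnorm (x : 'cV[R]_n) : R := \sum_i x i 0 ^+ 2.

Lemma qformE (M : 'M[R]_n) (x : 'cV[R]_n) : qform M x = \sum_i \sum_j x i 0 * M i j * x j 0.
Proof.
rewrite /qform mxE exchange_big /=; apply: eq_bigr => j _.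
by rewrite mxE mulr_suml; apply: eq_bigr => i _; rewrite mxE.
Qed.

Lemma sqnorm_ge0 (x : 'cV[R]_n) : 0 <= sqnorm x.
Proof. by apply: sumr_ge0 => i _; rewrite sqr_ge0. Qed.

(** Expand |s M + x x^T|_F^2 >= 0 with s = |x|^2: since |M|_F = 1, the left side equals 2 s (s +
    Q(x)). *)
Lemma qform_ge_frob (M : 'M[R]_n) (x : 'cV[R]_n) : \sum_i \sum_j M i j ^+ 2 = 1 -> - sqnorm x <= qform M x.
Proof.
move=> M1; have [x0|x_neq0] := eqVneq (sqnorm x) 0.
  have xi0 i : x i 0 = 0.
    apply/eqP; rewrite -sqrf_eq0; apply/eqP.
    by apply: (psumr_eq0P (P := xpredT) _ x0) => // j _; rewrite sqr_ge0.
  by rewrite x0 oppr0 qformE; do 2![apply: sumr_ge0 => ? _]; rewrite !xi0 mul0r mul0r.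
have x_gt0 : 0 < sqnorm x by rewrite lt_def x_neq0 sqnorm_ge0.
have : 0 <= \sum_i \sum_j (sqnorm x * M i j + x i 0 * x j 0) ^+ 2.
  by do 2![apply: sumr_ge0 => ? _]; rewrite sqr_ge0.
suff -> : \sum_i \sum_j (sqnorm x * M i j + x i 0 * x j 0) ^+ 2 =
    2 * sqnorm x * (sqnorm x + qform M x).
  by rewrite pmulr_rge0 ?mulr_gt0 //; lra.
transitivity (sqnorm x ^+ 2 * (\sum_i \sum_j M i j ^+ 2) + 2 * sqnorm x * qform M x
   + \sum_i \sum_j (x i 0 ^+ 2 * x j 0 ^+ 2)); last first.
  rewrite M1; under [X in _ + X]eq_bigr => i _ do rewrite -mulr_sumr.
  by rewrite -mulr_suml -/(sqnorm x); ring.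
rewrite qformE; move: (sqnorm x) => s; rewrite !mulr_sumr -!big_split; apply: eq_bigr => i _ /=.
rewrite !mulr_sumr -!big_split; apply: eq_bigr => j _ /=.
ring.
Qed.

(** In the averaged form, [defect] multiplies the form on the whole block L, where the crude
    [qform_ge_frob] is used; this is affordable because [defect] is smaller than (m-t)/t by the
    factor m - 1. The term (m-t)/t meets only diagonal entries in L, which are at most [c]. *)
Lemma qform_lower_bound (M : 'M[R]_n) (L : {set 'I_n}) (t : nat) (c : R) (v : 'cV[R]_n) :
  (2 <= t <= #|L|)%N -> 0 <= c -> (forall i, i \in L -> M i i <= c) ->
  \sum_i \sum_j M i j ^+ 2 = 1 ->
  (forall T : {set 'I_n}, T \subset L -> #|T| = t ->
     forall x : 'cV_n, (forall i, i \notin ~: L :|: T -> x i 0 = 0) -> 0 <= qform M x) ->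
  - (defect L t + ((#|L| - t)%:R / t%:R + defect L t) * c) * sqnorm v <= qform M v.
Proof.
move=> /andP[t2 tL] c0 Mc M1 Mpos.
have t0 : 0 < t%:R :> R by rewrite ltr0n; lia.
have d0 : 0 <= defect L t :> R.
  rewrite /defect divr_ge0 ?ler0n // mulr_ge0 ?ler0n // subr_ge0 ler1n; lia.
have e0 : 0 <= (#|L| - t)%:R / t%:R + defect L t :> R.
  by rewrite addr_ge0 // divr_ge0 ?ler0n.
have : 0 <= \sum_(T in draws L t) qform M (\col_i (weight L t T i * v i 0)).
  apply: sumr_ge0 => T; rewrite inE => /andP[TL /eqP Tt].
  apply: (Mpos T) => // i; rewrite !inE negb_or negbK => /andP[iL iT].
  by rewrite mxE /weight iL (negbTE iT) /=; ring.
under eq_bigr => T _ do rewrite qformE.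
have -> : \sum_(T in draws L t) \sum_i \sum_j
     ((\col_i (weight L t T i * v i 0)) i 0 * M i j *
      (\col_i (weight L t T i * v i 0)) j 0 : R) =
   \sum_(T in draws L t) \sum_i \sum_j
     weight L t T i * weight L t T j * (v i 0 * M i j * v j 0).
  apply: eq_bigr => T _; apply: eq_bigr => i _; apply: eq_bigr => j _.
  by rewrite !mxE; ring.
rewrite avg_quad // pmulr_rge0 ?ltr0n ?draws_card_gt0 // -qformE.
set vL : 'cV[R]_n := \col_i (if i \in L then v i 0 else 0).
have -> : \sum_(i in L) \sum_(j in L) v i 0 * M i j * v j 0 = qform M vL.
  rewrite qformE big_mkcond; apply: eq_bigr => i _; rewrite mxE.
  case: (i \in L); last by rewrite big1 // => j _; rewrite !mul0r.
  rewrite big_mkcond; apply: eq_bigr => j _; rewrite mxE.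
  by case: (j \in L); rewrite ?mulr0.
have vLv : sqnorm vL <= sqnorm v.
  apply: ler_sum => i _; rewrite mxE; case: (i \in L) => //.
  by rewrite expr0n sqr_ge0.
have qL : - sqnorm v <= qform M vL.
  by apply: le_trans (qform_ge_frob M vL M1); rewrite lerN2.
have diag : \sum_(i in L) v i 0 * M i i * v i 0 <= c * sqnorm v.
  rewrite mulr_sumr [leLHS]big_mkcond; apply: ler_sum => i _.
  case: ifP => iL; last by rewrite mulr_ge0 ?sqr_ge0.
  by rewrite mulrAC -expr2 mulrC ler_wpM2r ?sqr_ge0 ?Mc.
have := ler_wpM2l d0 qL; have := ler_wpM2l e0 diag.
lra.
Qed.

End QuadraticForm.

(** * Eigenvalues and approximation by a PSD matrix *)

(** The columns of [K] encode #|I| + #|J| < n homogeneous linear equations in n unknowns, so its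
    left kernel is nonzero. *)
Lemma exists_common_zero {F : fieldType} {n : nat} (P : 'M[F]_n) (I J : {set 'I_n}) :
  (#|I| + #|J| < n)%N ->
  exists c : 'rV[F]_n, [/\ c != 0, forall i, i \in I -> c 0 i = 0
                         & forall j, j \in J -> (c *m P) 0 j = 0].
Proof.
move=> ltn; pose K := row_mx (colsub (@enum_val _ (mem I)) 1%:M) (colsub (@enum_val _ (mem J)) P).
have kerK : kermx K != 0.
  rewrite kermx_eq0 /row_free neq_ltn; apply/orP; left.
  exact: leq_ltn_trans (rank_leq_col K) ltn.
have /rowV0Pn[c cK c0] : kermx K != 0 := kerK.
have cK0 : c *m K = 0 by apply/sub_kermxP.
have := cK0; rewrite mul_mx_row => /eqP; rewrite row_mx_eq0 => /andP[/eqP cI /eqP cJ].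
exists c; split=> // [i iI|j jJ].
  have /rowP/(_ (enum_rank_in iI i)) := cI.
  by rewrite mulmx_colsub mulmx1 !mxE enum_rankK_in.
have /rowP/(_ (enum_rank_in jJ j)) := cJ.
by rewrite mulmx_colsub mxE enum_rankK_in ?mxE.
Qed.

Section Spectral.
Local Open Scope sesquilinear_scope.
Context {R : rcfType} {n : nat}.
Local Notation C := R[i].
Local Notation toC := (map_mx (real_complex R)).
Local Notation Re := (@complex.Re R).
Local Notation Im := (@complex.Im R).

Lemma Re_sum (I : finType) (F : I -> C) : Re (\sum_i F i) = \sum_i Re (F i).
Proof. by apply: (big_morph Re) => // -[a b] [c d]. Qed.

Lemma sqr_normC (z : C) : z * z^* = (Re z ^+ 2 + Im z ^+ 2)%:C%C.
Proof. by rewrite -normCK add_Re2_Im2. Qed.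

Definition re_col (y : 'rV[C]_n) : 'cV[R]_n := \col_i Re (y 0 i).
Definition im_col (y : 'rV[C]_n) : 'cV[R]_n := \col_i Im (y 0 i).

(** For y = a + ib and real M the cross terms are purely imaginary. This carries bounds on Q at real
    vectors over to complex eigenvectors. *)
Lemma Re_hform (M : 'M[R]_n) (y : 'rV[C]_n) :
  Re ((y *m toC M *m y^t*) 0 0) = qform M (re_col y) + qform M (im_col y).
Proof.
rewrite mxE Re_sum !qformE [in RHS]exchange_big [X in _ = _ + X]exchange_big -big_split.
apply: eq_bigr => j _ /=.
rewrite mxE mulr_suml Re_sum -big_split; apply: eq_bigr => i _.
rewrite !mxE; case: (y 0 i) => a b; case: (y 0 j) => c d /=.
by ring.
Qed.

(** Over [R[i]] the matrix is hermitian, hence unitarily diagonalisable with real eigenvalues; [d]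
    can therefore be real although [P] is complex. *)
Lemma symmetric_spectral (M : 'M[R]_n) : M^T = M ->
  exists P : 'M[C]_n, exists d : 'rV[R]_n,
    P \is unitarymx /\ toC M = P^t* *m diag_mx (toC d) *m P.
Proof.
move=> symM; have real x : real_complex R x \is Num.real.
  by apply/complex_realP; exists x.
have herm : toC M \is hermsymmx.
  apply: realsym_hermsym; last by apply/mxOverP => i j; rewrite mxE.
  apply/is_hermitianmxP; rewrite expr0 scale1r map_mx_id //.
  by rewrite map_trmx symM.
exists (spectralmx (toC M)), (map_mx Re (spectral_diag (toC M))).
split; first exact: spectral_unitarymx.
have -> : toC (map_mx Re (spectral_diag (toC M))) = spectral_diag (toC M).
  apply/matrixP => i j; rewrite !mxE RRe_real //.
  exact/mxOverP/hermitian_spectral_diag_real.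
rewrite -invmx_unitary ?spectral_unitarymx //.
exact/orthomx_spectralP/hermitian_normalmx.
Qed.

Section Unitary.
Variables (P : 'M[C]_n).
Hypothesis unP : P \is unitarymx.

(* Taking real parts spares a proof that the positive part of a real symmetric
   matrix is real; it preserves positivity and does not increase the norm. *)
Definition re_conj (d : 'rV[R]_n) : 'M[R]_n :=
  map_mx Re (P^t* *m diag_mx (toC d) *m P).

Lemma re_conjE (d : 'rV[R]_n) (i j : 'I_n) : re_conj d i j =
  \sum_k d 0 k * (Re (P k i) * Re (P k j) + Im (P k i) * Im (P k j)).
Proof.
rewrite mxE mul_mx_diag mxE Re_sum; apply: eq_bigr => k _; rewrite !mxE.
by case: (P k i) => a b; case: (P k j) => a' b' /=; ring.
Qed.

Lemma re_conj_sym (d : 'rV[R]_n) : (re_conj d)^T = re_conj d.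
Proof.
by apply/matrixP => i j; rewrite mxE !re_conjE; apply: eq_bigr => k _; ring.
Qed.

(** The form at x is the sum over k of d_k |(P x)_k|^2. *)
Lemma re_conj_ge0 (d : 'rV[R]_n) (x : 'cV[R]_n) : (forall k, 0 <= d 0 k) -> 0 <= qform (re_conj d) x.
Proof.
move=> d0; suff -> : qform (re_conj d) x = \sum_k d 0 k *
    ((\sum_i x i 0 * Re (P k i)) ^+ 2 + (\sum_i x i 0 * Im (P k i)) ^+ 2).
  by apply: sumr_ge0 => k _; rewrite mulr_ge0 // addr_ge0 ?sqr_ge0.
rewrite qformE.
transitivity (\sum_k \sum_i \sum_j x i 0 *
   (d 0 k * (Re (P k i) * Re (P k j) + Im (P k i) * Im (P k j))) * x j 0).
  rewrite [RHS]exchange_big; apply: eq_bigr => i _ /=.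
  rewrite [RHS]exchange_big; apply: eq_bigr => j _ /=.
  by rewrite re_conjE mulr_sumr mulr_suml.
apply: eq_bigr => k _; rewrite !expr2 !mulr_suml -big_split mulr_sumr.
apply: eq_bigr => i _ /=; rewrite !mulr_sumr -big_split mulr_sumr.
by apply: eq_bigr => j _ /=; ring.
Qed.

(** For the complex matrix [E], the trace of E E^* is the sum of the d_k^2 because P is unitary;
    passing to real parts drops the squared imaginary parts of the entries. *)
Lemma re_conj_frob (d : 'rV[R]_n) : \sum_i \sum_j re_conj d i j ^+ 2 <= \sum_k d 0 k ^+ 2.
Proof.
pose E := P^t* *m diag_mx (toC d) *m P.
have trE : \tr (E *m E^t*) = \sum_k (d 0 k ^+ 2)%:C%C.
  rewrite /E !trmx_mul !map_mxM !mulmxA trmxCK mulmxtVK // mxtrace_mulC !mulmxA.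
  rewrite (unitarymxP unP) mul1mx tr_diag_mx map_diag_mx mulmx_diag mxtrace_diag.
  apply: eq_bigr => k _; rewrite !mxE.
  by apply: (etrans (sqr_normC _)); rewrite /= expr0n addr0.
rewrite -lecR [leRHS]rmorph_sum [leLHS]rmorph_sum /= -trE /mxtrace.
apply: ler_sum => i _; rewrite mxE rmorph_sum /=; apply: ler_sum => j _.
rewrite [E^t* _ _]mxE [E^T _ _]mxE sqr_normC lecR mxE -/E lerDl sqr_ge0 //.
Qed.

Variables (M : 'M[R]_n) (d : 'rV[R]_n).
Hypothesis defM : toC M = P^t* *m diag_mx (toC d) *m P.

(** The rows of [P] are orthonormal eigenvectors of [M], and [c] lists coordinates with respect to
    them. *)
Lemma qform_eigen (c : 'rV[C]_n) :
  qform M (re_col (c *m P)) + qform M (im_col (c *m P))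
  = \sum_k d 0 k * (Re (c 0 k) ^+ 2 + Im (c 0 k) ^+ 2).
Proof.
rewrite -Re_hform defM trmx_mul map_mxM !mulmxA !mulmxtVK //.
rewrite mul_mx_diag mxE Re_sum; apply: eq_bigr => k _; rewrite !mxE.
by case: (c 0 k) => a b /=; ring.
Qed.

Lemma sqnorm_unitary (c : 'rV[C]_n) :
  sqnorm (re_col (c *m P)) + sqnorm (im_col (c *m P))
  = \sum_k (Re (c 0 k) ^+ 2 + Im (c 0 k) ^+ 2).
Proof.
have E (y : 'rV[C]_n) : (\sum_k (Re (y 0 k) ^+ 2 + Im (y 0 k) ^+ 2))%:C%C = (y *m y^t*) 0 0.
  by rewrite rmorph_sum mxE; apply: eq_bigr => k _; rewrite !mxE sqr_normC.
rewrite /sqnorm -big_split /=; apply: (@complexI R).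
under eq_bigr => k _ do rewrite !mxE -/(((c *m P)) 0 k).
transitivity (((c *m P) *m (c *m P)^t*) 0 0); last first.
  by rewrite trmx_mul map_mxM mulmxA mulmxtVK // E.
by rewrite -E; congr (_%:C%C); apply: eq_bigr => k _; rewrite !mxE.
Qed.

(** Add the hypothesis at the real and imaginary parts of row k of [P]: their squared norms sum to 1
    and their forms to d_k. *)
Lemma eigen_lower_bound (lam : R) :
  (forall x : 'cV_n, - lam * sqnorm x <= qform M x) -> forall k, - lam <= d 0 k.
Proof.
move=> low k; have := lerD (low (re_col (delta_mx 0 k *m P))) (low (im_col (delta_mx 0 k *m P))).
rewrite -mulrDr qform_eigen sqnorm_unitary.
rewrite (bigD1 k) // [in leRHS](bigD1 k) //= !big1 ?mxE ?eqxx /=; last 2 first.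
- by move=> i ik; rewrite mxE (negbTE ik) /= expr0n !addr0 ?mulr0.
- by move=> i ik; rewrite mxE (negbTE ik) /= expr0n !addr0 ?mulr0.
by rewrite expr1n expr0n !addr0 !mulr1.
Qed.

(* Otherwise some nonzero combination of the negative eigenvectors is supported
   on S, since the complement of S imposes only n - #|S| linear conditions. *)
Lemma card_neg_eigen (S : {set 'I_n}) :
  (forall x : 'cV_n, (forall i, i \notin S -> x i 0 = 0) -> 0 <= qform M x) ->
  (#|[set k | (d 0 k < 0)%R]| <= n - #|S|)%N.
Proof.
move=> pos; rewrite leqNgt; apply/negP; set K := [set k | _] => big.
have [|c [c0 cI cJ]] := exists_common_zero P (~: K) (~: S).
  rewrite [#|~: K|]cardsCs [#|~: S|]cardsCs !finset.setCK !card_ord.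
  have : (#|K| <= n)%N by rewrite -[leqRHS](card_ord n) max_card.
  have : (#|S| <= n)%N by rewrite -[leqRHS](card_ord n) max_card.
  move: big; move: #|K| #|S| => x y; lia.
have neg k : d 0 k * (Re (c 0 k) ^+ 2 + Im (c 0 k) ^+ 2) <= 0.
  have [dk|dk] := ltP (d 0 k) 0.
    by rewrite mulr_le0_ge0 ?addr_ge0 ?sqr_ge0 // ltW.
  by rewrite cI ?inE -?leNgt //= !expr0n addr0 mulr0.
(* Each term is <= 0, while the sum is >= 0 because both parts of c P vanish off S. So all terms
   vanish, which forces c_k = 0 also where d_k < 0. *)
have sum0 : \sum_k d 0 k * (Re (c 0 k) ^+ 2 + Im (c 0 k) ^+ 2) = 0.
  apply/eqP; rewrite eq_le sumr_le0 //= -qform_eigen addr_ge0 // pos // => i iS.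
    by rewrite mxE cJ ?inE.
  by rewrite mxE cJ ?inE.
case/eqP: c0; apply/rowP => k; rewrite [RHS]mxE.
have [dk|dk] := ltP (d 0 k) 0; last by rewrite cI // inE inE -leNgt.
have /eqP : d 0 k * (Re (c 0 k) ^+ 2 + Im (c 0 k) ^+ 2) = 0.
  apply/eqP; rewrite -oppr_eq0; apply/eqP.
  apply: (psumr_eq0P (P := xpredT) (F := fun k => - (d 0 k * (Re (c 0 k) ^+ 2 + Im (c 0 k) ^+ 2)))) => //.
    by move=> i _; rewrite oppr_ge0.
  by rewrite sumrN sum0 oppr0.
rewrite mulf_eq0 lt_eqF //= paddr_eq0 ?sqr_ge0 // !sqrf_eq0.
by case: (c 0 k) => a b /= /andP[/eqP-> /eqP->].
Qed.

End Unitary.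

Lemma psd_approx (M : 'M[R]_n) (lam : R) (S : {set 'I_n}) :
  M^T = M -> 0 <= lam -> (forall x : 'cV_n, - lam * sqnorm x <= qform M x) ->
  (forall x : 'cV_n, (forall i, i \notin S -> x i 0 = 0) -> 0 <= qform M x) ->
  exists N : 'M[R]_n, [/\ N^T = N, forall x : 'cV_n, 0 <= qform N x &
    \sum_i \sum_j (M - N) i j ^+ 2 <= (n - #|S|)%:R * lam ^+ 2].
Proof.
move=> symM lam0 low pos; have [P [d [unP defM]]] := symmetric_spectral M symM.
pose dp : 'rV[R]_n := \row_k Num.max (d 0 k) 0.
exists (re_conj P dp); split; first exact: re_conj_sym.
  by move=> x; apply: re_conj_ge0 => k; rewrite mxE le_max lexx orbT.
(* Taking real parts loses nothing on the real matrix M, so M - N is again a [re_conj], by linearity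
   in the eigenvalues. *)
have defMR : M = re_conj P d.
  by rewrite /re_conj -defM; apply/matrixP => i j; rewrite !mxE.
have -> : M - re_conj P dp = re_conj P (d - dp).
  apply/matrixP => i j; rewrite {1}defMR [LHS]mxE [X in _ + X]mxE !re_conjE -sumrB.
  by apply: eq_bigr => k _; rewrite -mulrBl !mxE.
apply: (le_trans (re_conj_frob P unP _)).
(* d - dp keeps just the negative eigenvalues, each at least -lam. *)
apply: (@le_trans _ _ (\sum_(k in [set k | d 0 k < 0]) lam ^+ 2)).
  rewrite [leRHS]big_mkcond; apply: ler_sum => k _; rewrite inE !mxE.
  have [dk|dk] := ltP (d 0 k) 0; last by rewrite subrr expr0n.
  rewrite subr0 -sqrrN; apply: lerXn2r; rewrite ?nnegrE ?oppr_ge0 ?(ltW dk) //.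
  by rewrite lerNl (eigen_lower_bound P unP M d defM).
rewrite sumr_const -[leLHS]mulr_natl ler_wpM2r ?sqr_ge0 // ler_nat.
exact: (card_neg_eigen P unP M d defM S pos).
Qed.

End Spectral.

(** * Matrices in the k-PSD closure *)

(** This makes [enum_val] an admissible index map in [kpsd]; [enum S] filters the increasing
    enumeration of 'I_n. *)
Lemma enum_val_increasing (n : nat) (S : {set 'I_n}) (i j : 'I_#|S|) :
  (i < j)%N -> (enum_val i < enum_val j)%N.
Proof.
move=> ltij; have trans : transitive (relpre (@nat_of_ord n) ltn).
  by move=> y x z /=; exact: ltn_trans.
have sortedS : sorted (relpre (@nat_of_ord n) ltn) (enum S).
  rewrite /enum_mem; apply: sorted_filter => //.
  by rewrite -sorted_map -enumT val_enum_ord iota_ltn_sorted.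
(* The default inside [enum_val i] depends on [i]; both [nth] must share one default before
   sortedness applies. *)
rewrite /enum_val (set_nth_default (enum_default j)) -?cardE //.
by apply: (sorted_ltn_nth trans _ sortedS); rewrite // inE -cardE.
Qed.

Section Bounds.
Context {R : realType} {n k : nat}.
Variable M : 'M[R]_n.

(** Q(x) is the form of the principal submatrix on S, evaluated at the restriction of x to S. *)
Lemma kpsd_qform_ge0 (S : {set 'I_n}) (x : 'cV[R]_n) : kpsd k M -> #|S| = k ->
  (forall i, i \notin S -> x i 0 = 0) -> 0 <= qform M x.
Proof.
move=> + cS xS; rewrite -cS => -[_ /(_ _ (@enum_val_increasing n S))[_ pos]].
have := pos (\col_i x (enum_val i) 0); rewrite -/(qform _ _) !qformE.
suff -> : \sum_i \sum_j x i 0 * M i j * x j 0 =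
    \sum_(i in S) \sum_(j in S) x i 0 * M i j * x j 0.
  rewrite [X in _ -> 0 <= X]big_enum_val; congr (_ <= _); apply: eq_bigr => i _.
  by rewrite [RHS]big_enum_val; apply: eq_bigr => j _; rewrite !mxE.
rewrite [RHS]big_mkcond; apply: eq_bigr => i _.
case: ifPn => iS; last by rewrite big1 // => j _; rewrite xS // !mul0r.
rewrite [RHS]big_mkcond; apply: eq_bigr => j _.
by case: ifPn => // jS; rewrite (xS j) // mulr0.
Qed.

Definition light : {set 'I_n} := [set i | M i i <= 2 / Num.sqrt n%:R].

(** An index outside [light] has M_ii > 2 / sqrt n, so its row contributes more than 4/n to a total
    of 1. *)
Lemma card_light : (0 < n)%N -> \sum_i \sum_j M i j ^+ 2 = 1 ->
  (3 * n <= 4 * #|light|)%N.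
Proof.
move=> n0 M1; have n0' : 0 < n%:R :> R by rewrite ltr0n.
suff : (4 * #|~: light| <= n)%N by have := cardsC light; rewrite card_ord; lia.
rewrite -(ler_nat R) natrM -[leRHS]mul1r -ler_pdivrMr // -[leRHS]M1.
have -> : 4 * #|~: light|%:R / n%:R = \sum_(i in ~: light) (4 / n%:R : R).
  by rewrite sumr_const -[RHS]mulr_natl; ring.
rewrite [leLHS]big_mkcond; apply: ler_sum => i _.
have diag : M i i ^+ 2 <= \sum_j M i j ^+ 2.
  by rewrite (bigD1 i) //= lerDl sumr_ge0 // => j _; rewrite sqr_ge0.
case: ifPn => iL; last by apply: le_trans diag; rewrite sqr_ge0.
apply: le_trans diag.
have -> : 4 / n%:R = (2 / Num.sqrt n%:R) ^+ 2 :> R.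
  by rewrite expr_div_n sqr_sqrtr ?ler0n // -natrX.
move: iL; rewrite !inE -ltNge => iL.
by rewrite lerXn2r ?nnegrE ?divr_ge0 ?sqrtr_ge0 // ?ltW // (le_lt_trans _ iL) ?divr_ge0 ?sqrtr_ge0.
Qed.

Lemma kpsd_lower_bound (x : 'cV[R]_n) :
  (97 <= n)%N -> (3 * n <= 4 * k)%N -> (k <= n)%N -> kpsd k M ->
  \sum_i \sum_j M i j ^+ 2 = 1 ->
  - (6 * (n - k)%:R / Num.sqrt n%:R ^+ 3) * sqnorm x <= qform M x.
Proof.
move=> n97 k34 kn psdM M1.
set s := Num.sqrt n%:R; set r := (n - k)%:R.
have s2 : s ^+ 2 = n%:R by rewrite sqr_sqrtr ?ler0n.
(* 81 <= 97 <= n; the estimate [dt] below needs s >= 60/7. *)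
have s9 : 9 <= s.
  rewrite -(@ler_pXn2r _ 2) ?nnegrE ?sqrtr_ge0 // s2 -natrX ler_nat; lia.
have s0 : 0 < s by lra.
have mL := @card_light (ltn_trans (isT : 0 < 96)%N n97) M1.
have mn : (#|light| <= n)%N by rewrite -[leqRHS](card_ord n) max_card.
set m := #|light| in mL mn *.
(* With this size, [~: light :|: T] has (n - m) + t = k elements. *)
pose t := (m - (n - k))%N.
have mt : (m - t)%N = (n - k)%N by rewrite /t; lia.
have c0 : 0 <= 2 / s by rewrite divr_ge0 // ltW.
have := @qform_lower_bound _ _ M light t (2 / s) x _ c0 _ M1 _.
rewrite -/m => bound; apply: le_trans (bound _ _ _).
- rewrite ler_wpM2r ?sqnorm_ge0 // lerN2 /defect -/m mt -/r.
  have r0 : 0 <= r by rewrite ler0n.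
  (* m >= 3n/4 and n - k <= n/4 give t >= n/2. *)
  have tn : s ^+ 2 / 2 <= t%:R.
    rewrite s2 ler_pdivrMr // -natrM ler_nat /t; lia.
  have m1n : s ^+ 2 * (7 / 10) <= m%:R - 1.
    have : (7 * n + 10 <= 10 * m)%N by lia.
    rewrite -(ler_nat R) natrD !natrM s2; lra.
  have t0 : 0 < t%:R :> R by apply: lt_le_trans tn; rewrite divr_gt0 ?exprn_gt0.
  have m0 : 0 < m%:R - 1 :> R by apply: lt_le_trans m1n; rewrite mulr_gt0 ?exprn_gt0 //; lra.
  (* In units of [u], the lone [defect] costs at most 1/3 and the diagonal term at most 5, which
     together stay below 6. *)
  pose u := r / s ^+ 3.
  have ru : r = u * s ^+ 3 by rewrite /u divfK // expf_neq0 // gt_eqF.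
  have u0 : 0 <= u by rewrite divr_ge0 // exprn_ge0 // ltW.
  have rt : r / t%:R <= 2 * u * s.
    rewrite ler_pdivrMr // ru.
    have := ler_wpM2l (mulr_ge0 (mulr_ge0 (ler0n R 2) u0) (ltW s0)) tn; lra.
  have dt : r / (t%:R * (m%:R - 1)) <= u / 3.
    rewrite ler_pdivrMr ?mulr_gt0 // ru.
    have p : s ^+ 2 / 2 * (s ^+ 2 * (7 / 10)) <= t%:R * (m%:R - 1).
      by rewrite ler_pM // mulr_ge0 ?exprn_ge0 ?(ltW s0) //; lra.
    have := ler_wpM2l (divr_ge0 u0 (ler0n R 3)) p.
    have := ler_wpM2l (mulr_ge0 u0 (exprn_ge0 3 (ltW s0))) s9; lra.
  have -> : 6 * r / s ^+ 3 = 6 * u by rewrite /u mulrA.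
  have rd : (r / t%:R + r / (t%:R * (m%:R - 1))) * (2 / s) <= 5 * u.
    rewrite mulrA ler_pdivrMr //.
    have := ler_wpM2l u0 s9; lra.
  lra.
- by rewrite /t; lia.
- by move=> i; rewrite inE.
- move=> T TL cT y yS; apply: (@kpsd_qform_ge0 (~: light :|: T)) => //.
  have /eqP-> : #|~: light :|: T| == (#|~: light| + #|T|)%N.
    by rewrite (leq_card_setU _ _) disjoint_sym finset.disjoints_subset finset.setCK.
  by have := cardsC light; rewrite card_ord cT /t -/m; lia.
Qed.

End Bounds.

Theorem theorem2 (R : realType) (n k : nat) :
  (97 <= n)%N -> (3 * n <= 4 * k)%N -> (k <= n)%N ->
  (supdistF_psd [set M : 'M[R]_n | kpsd k M]
     <= (96 * (((n - k)%:R / n%:R) `^ (3 / 2)))%:E)%E.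
Proof.
move=> n97 k34 kn; apply: ub_ereal_sup => _ [M /= [psdM frobM] <-].
have M1 : \sum_i \sum_j M i j ^+ 2 = 1.
  have /(congr1 (fun x => x ^+ 2)) := frobM.
  rewrite expr1n sqr_sqrtr //.
  by do 2![apply: sumr_ge0 => ? _]; rewrite sqr_ge0.
pose s : R := Num.sqrt n%:R; pose r : R := (n - k)%:R.
pose lam := 6 * r / s ^+ 3.
have lam0 : 0 <= lam by rewrite divr_ge0 ?exprn_ge0 ?sqrtr_ge0 // mulr_ge0 // ler0n.
(* Any k-element set would serve to bound the number of negative eigenvalues by n - k. *)
pose S : {set 'I_n} := [set i : 'I_n | (i < k)%N].
have cS : #|S| = k.
  rewrite -sum1_card big_mkcond /=.
  transitivity (\sum_(i < n | (i < k)%N) 1)%N; last first.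
    by rewrite -(big_ord_widen n (fun=> 1%N)) // sum_nat_const card_ord muln1.
  by rewrite [RHS]big_mkcond; apply: eq_bigr => i _; rewrite inE.
have [N [symN posN frobN]] := @psd_approx _ _ M lam S (proj1 psdM) lam0
  (fun x => kpsd_lower_bound _ x n97 k34 kn psdM M1)
  (fun x => kpsd_qform_ge0 _ S x psdM cS).
apply: (@le_trans _ _ (frob (M - N))%:E).
  by apply: ereal_inf_lbound; exists N.
rewrite lee_fin; set q : R := Num.sqrt (r / n%:R).
have q2 : q ^+ 2 = r / n%:R by rewrite sqr_sqrtr // divr_ge0 ?ler0n.
have -> : (r / n%:R) `^ (3 / 2) = q ^+ 3.
  by rewrite [3 / 2]mulrC powRrM powR12_sqrt ?divr_ge0 ?ler0n // powR_mulrn ?sqrtr_ge0.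
have q30 : 0 <= q ^+ 3 by rewrite exprn_ge0 ?sqrtr_ge0.
(* The argument yields the constant 6, which is weakened to 96 here. *)
apply: (@le_trans _ _ (6 * q ^+ 3)); last by lra.
rewrite /frob -(@ler_pXn2r _ 2) ?nnegrE ?sqrtr_ge0 ?(mulr_ge0 _ q30) //.
rewrite sqr_sqrtr; last by do 2![apply: sumr_ge0 => ? _]; rewrite sqr_ge0.
apply: (le_trans frobN); rewrite cS -/r.
have n0 : n%:R != 0 :> R by rewrite pnatr_eq0; lia.
(* Both sides equal 36 r^3 / n^3, since s^2 = n. *)
rewrite le_eqVlt; apply/orP; left; apply/eqP.
have -> : lam ^+ 2 = 36 * r ^+ 2 / (s ^+ 2) ^+ 3 by rewrite /lam expr_div_n -!exprM; congr (_ / _); ring.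
have -> : (6 * q ^+ 3) ^+ 2 = 36 * (q ^+ 2) ^+ 3 by ring.
rewrite q2 sqr_sqrtr ?ler0n //.
by field.
Qed.
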